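(* Let $\ell,n,m\in\mathbb{N}^*=\{1,2,\dots\}$. The set $$S=\left\{(E,A,B)\in\Sigma_{\ell,n,m}\;\middle|\;\text{the system } \tfrac{\mathrm{d}}{\mathrm{d}t}(Ex)=Ax+Bu \text{ is strongly stabilizable}\right\}$$ is generic if, and only if, $\ell<n+m$.
   Context: $\Sigma_{\ell,n,m}:=\mathbb{R}^{\ell\times n}\times\mathbb{R}^{\ell\times n}\times\mathbb{R}^{\ell\times m}$, identified with $\mathbb{R}^{2\ell n+\ell m}$ by listing matrix entries. A set $\mathbb{V}\subseteq\mathbb{R}^N$ is an algebraic variety if it is the set of common zeros of finitely many polynomials in $\mathbb{R}[x_1,\dots,x_N]$; it is proper if $\mathbb{V}\neq\mathbb{R}^N$. A set $S\subseteq\mathbb{R}^N$ is generic if its complement is contained in some proper algebraic variety. A mapping $(x,u):\mathbb{R}\to\mathbb{R}^n\times\mathbb{R}^m$ is a solution of $\tfrac{\mathrm{d}}{\mathrm{d}t}(Ex)=Ax+Bu$ if $x\in\mathcal{L}^1_{\mathrm{loc}}(\mathbb{R},\mathbb{R}^n)$, $u\in\mathcal{L}^1_{\mathrm{loc}}(\mathbb{R},\mathbb{R}^m)$ (locally integrable functions), $Ex:\mathbb{R}\to\mathbb{R}^\ell$ is (locally) absolutely continuous, and $\tfrac{\mathrm{d}}{\mathrm{d}t}(Ex)(t)=Ax(t)+Bu(t)$ for all $t$ outside a Lebesgue nullset. The set of all solutions is denoted $\mathfrak{B}_{[E,A,B]}$. The system $(E,A,B)$ is strongly stabilizable if for every $x_0\in\mathbb{R}^n$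 there exists $(x,u)\in\mathfrak{B}_{[E,A,B]}$ with $Ex(0)=Ex_0$ and $\lim_{t\to\infty}Ex(t)=0$. *)

(* Defs.v *)
From HB Require Import structures.
From mathcomp Require Import all_boot all_order all_algebra.
From mathcomp Require Import all_classical all_reals all_analysis.
(* Not imported: the notations of mpoly clash with those of
   MathComp-Analysis. *)
From mathcomp Require mpoly.

Set Implicit Arguments.
Unset Strict Implicit.
Unset Printing Implicit Defensive.

Import Order.TTheory GRing.Theory Num.Theory.
Import numFieldNormedType.Exports.

Local Open Scope classical_set_scope.
Local Open Scope ring_scope.

Definition algebraic_variety (R : realType) (N : nat) (V : set 'rV[R]_N) :=
  exists (k : nat) (p : 'I_k -> mpoly.mpoly N R),
    V = [set v | forall i, mpoly.meval (fun j => v 0 j) (p i) = 0].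

Definition generic (R : realType) (N : nat) (S : set 'rV[R]_N) :=
  exists V : set 'rV[R]_N,
    [/\ algebraic_variety V, V <> setT & ~` S `<=` V].

Definition Sigma (R : realType) (l n m : nat) : Type :=
  ('M[R]_(l, n) * 'M[R]_(l, n) * 'M[R]_(l, m))%type.

Definition Sigma_vec (R : realType) (l n m : nat) (s : Sigma R l n m) :
    'rV[R]_(l * n + l * n + l * m) :=
  row_mx (row_mx (mxvec s.1.1) (mxvec s.1.2)) (mxvec s.2).

(* In the library, measurability on R is with respect to the Borel sets;
   passing to an a.e. equal function gives Lebesgue measurability. *)
Definition L1loc (R : realType) (n : nat) (x : R -> 'cV[R]_n) :=
  forall i : 'I_n, exists2 g : R -> R, locally_integrable setT g
    & {ae (@lebesgue_measure R), forall t, x t i 0 = g t}.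

Definition abs_continuous_on (R : realType) (V : normedModType R) (a b : R)
    (f : R -> V) :=
  forall e : R, 0 < e -> exists2 d : R, 0 < d &
    forall (k : nat) (s t : 'I_k -> R),
      (forall i, [/\ a <= s i, s i <= t i & t i <= b]) ->
      trivIset setT (fun i => `]s i, t i[%classic) ->
      \sum_(i < k) (t i - s i) < d ->
      \sum_(i < k) `|f (t i) - f (s i)| < e.

Definition loc_abs_continuous (R : realType) (V : normedModType R)
    (f : R -> V) :=
  forall a b : R, a <= b -> abs_continuous_on a b f.

Definition behavior (R : realType) (l n m : nat)
    (E A : 'M[R]_(l, n)) (B : 'M[R]_(l, m)) :
    set ((R -> 'cV[R]_n) * (R -> 'cV[R]_m)) :=
  [set xu | [/\ L1loc xu.1, L1loc xu.2,
    loc_abs_continuous (fun t => E *m xu.1 t) &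
    {ae (@lebesgue_measure R), forall t : R,
      is_derive t 1 (fun s : R => E *m xu.1 s)
        (A *m xu.1 t + B *m xu.2 t)}]].

Definition strongly_stabilizable (R : realType) (l n m : nat)
    (E A : 'M[R]_(l, n)) (B : 'M[R]_(l, m)) :=
  forall x0 : 'cV[R]_n, exists xu : (R -> 'cV[R]_n) * (R -> 'cV[R]_m),
    [/\ behavior E A B xu, E *m xu.1 0 = E *m x0 &
        E *m xu.1 t @[t --> +oo] --> (0 : 'cV[R]_l)].

(* Main.v *)
Require Import Defs.
From mathcomp Require Import all_boot all_order all_algebra.
From mathcomp Require Import all_classical all_reals all_analysis.
From mathcomp Require Import measurable_realfun ring lra.
From mathcomp Require mpoly.
Import (canonicals) mpoly.

(* If [l < n + m], each pencil [[(k+1) E + A, B]] has a kernel vector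
   [(xi_k, eta_k)] polynomial in the entries (maximal minors), and it yields the
   solution [exp (- (k+1) t) (xi_k, eta_k)].  Generically the vectors [E xi_k],
   [k < min l n], span the range of [E], so that combinations of these decaying
   solutions attain every consistent initial value.

   If [n + m <= l], eliminating [u] by a Schur complement near
   [E = A = [I; 0; 0]], [B = [0; I; 0]] gives a matrix [M] with [M B = 0] and
   [(M E)^T (M A)] close to the identity; hence [|M E x|^2] is nondecreasing along
   every solution and [E x] cannot tend to 0 unless [M E x(0) = 0].  A proper
   variety contains no such neighbourhood. *)

Set Implicit Arguments.
Unset Strict Implicit.
Unset Printing Implicit Defensive.

Import Order.TTheory GRing.Theory Num.Theory.
Import numFieldNormedType.Exports.

Local Open Scope classical_set_scope.
Local Open Scope ring_scope.

(** * A polynomial criterion for stabilizability *)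

Section Criterion.
Variables (S : comNzRingType) (l n m : nat).
Implicit Types (E A : 'M[S]_(l, n)) (B : 'M[S]_(l, m)).

(* [v] solves [d/dt (E x) = A x + B u] along [exp (- k.+1 t) v] iff
   [pencil E A B k *m v = 0]. *)
Definition pencil E A B (k : nat) : 'M[S]_(l, n + m) :=
  row_mx (k.+1%:R *: E + A) B.

(* The first [l + 1] columns of the pencil, completed to a square matrix; the
   last column of its adjugate consists of the maximal minors of these columns,
   a kernel vector polynomial in [E], [A], [B]. *)
Definition bordered_pencil E A B k : 'M[S]_(l + 1) :=
  col_mx (pencil E A B k *m pid_mx (l + 1)) (pid_mx 1).

Definition pencil_kernel E A B k : 'cV[S]_(n + m) :=
  pid_mx (l + 1) *m (\adj (bordered_pencil E A B k) *m delta_mx (rshift l 0) 0).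

Definition kernel_states E A B (r : nat) : 'M[S]_(n, r) :=
  \matrix_(i, k) usubmx (pencil_kernel E A B k) i 0.

(** Over a field, a nonzero value gives [E *m kernel_states E A B (minn l n)] the largest rank
    possible for an [l] by [n] matrix, so its columns span the range of [E]. *)
Definition criterion E A B : S :=
  \det (pid_mx (minn l n) *m E *m kernel_states E A B (minn l n)).

(** The bordered pencil times its adjugate is a scalar matrix, whose last column vanishes in the
    first [l] rows, those coming from the pencil. *)
Lemma pencil_kernelP E A B k : pencil E A B k *m pencil_kernel E A B k = 0.
Proof.
rewrite mulmxA mulmxA.
have := mul_mx_adj (bordered_pencil E A B k); set Ad := \adj _.
rewrite mul_col_mx => /(congr1 usubmx); rewrite col_mxKu => ->.
apply/matrixP => i j; rewrite !mxE big1// => a _; rewrite !mxE.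
case: (a =P rshift l 0) => [->|]; last by rewrite mulr0.
by rewrite (eqE (lshift _ _)) /= ltn_eqF ?mul0r// ltn_addr.
Qed.

End Criterion.

Section Morphism.
Variables (S T : comNzRingType) (f : {rmorphism S -> T}) (l n m : nat).
Implicit Types (E A : 'M[S]_(l, n)) (B : 'M[S]_(l, m)).

(** With evaluation as [f], this identifies the criterion at indeterminates with a polynomial in the
    matrix entries. *)
Lemma map_criterion E A B :
  criterion (map_mx f E) (map_mx f A) (map_mx f B) = f (criterion E A B).
Proof.
rewrite /criterion -det_map_mx !map_mxM map_pid_mx; congr (\det (_ *m _)).
apply/matrixP => i k; rewrite !mxE rmorph_sum; apply: eq_bigr => a _.
rewrite rmorphM; congr (_ * _); first by rewrite !mxE rmorph_nat.
have -> : bordered_pencil (map_mx f E) (map_mx f A) (map_mx f B) k =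
          map_mx f (bordered_pencil E A B k).
  rewrite /bordered_pencil map_col_mx map_mxM /pencil map_row_mx map_mxD.
  by rewrite map_mxZ rmorph_nat !map_pid_mx.
rewrite -(map_delta_mx f) -map_mx_adj -map_mxM.
by rewrite !mxE.
Qed.

End Morphism.

Lemma mul_pid_mxE (S : pzSemiRingType) a b c p (M : 'M[S]_(b, c))
    (i : 'I_a) j (k : 'I_b) :
  i = k :> nat -> (i < p)%N -> (pid_mx p *m M : 'M[S]_(a, c)) i j = M k j.
Proof.
move=> ik ip; rewrite mxE (bigD1 k)//= mxE ik eqxx -ik ip mul1r big1 ?addr0//.
move=> d dk; rewrite mxE; case: eqP => [e|_]; last by rewrite mul0r.
by case/eqP: dk; apply/val_inj; rewrite /= -e.
Qed.

(** * A system at which the criterion does not vanish *)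

Section Witness.
Variables (R : numFieldType) (l n m : nat).

(* Every pencil of this system is bidiagonal, with superdiagonal entries 1, so
   its kernel vector is [(1, - k.+1, (- k.+1)^2, ...)] up to index [n] and 0
   beyond, and the criterion becomes a multiple of a Vandermonde determinant. *)
Definition witness_E : 'M[R]_(l, n) := pid_mx n.
Definition witness_A : 'M[R]_(l, n) := \matrix_(i, j) (j == i.+1 :> nat)%:R.
Definition witness_B : 'M[R]_(l, m) := \matrix_(i, j) (n + j == i.+1 :> nat)%:R.

Lemma pencil_witness k i j :
  pencil witness_E witness_A witness_B k i j =
  k.+1%:R * ((i == j :> nat) && (i < n)%N)%:R + (j == i.+1 :> nat)%:R.
Proof.
rewrite /pencil; case: (split_ordP j) => a ->.
  by rewrite row_mxEl !mxE.
rewrite row_mxEr !mxE /=; case: (i =P _ :> nat) => [->|_] /=.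
  by rewrite ltnNge leq_addr mulr0 add0r.
by rewrite mulr0 add0r.
Qed.

Hypothesis ln : (l < n + m)%N.

Lemma pencil_witness_mul k (v : 'cV[R]_(l + 1)) (i : 'I_l)
    (a b : 'I_(l + 1)) : a = i :> nat -> b = i.+1 :> nat ->
  (pencil witness_E witness_A witness_B k *m pid_mx (l + 1) *m v) i 0 =
  k.+1%:R * (i < n)%N%:R * v a 0 + v b 0.
Proof.
move=> ai bi; have ln1 : (l + 1 <= n + m)%N by rewrite addn1.
have colE (c : 'I_(l + 1)) :
    (pencil witness_E witness_A witness_B k *m
       (pid_mx (l + 1) : 'M[R]_(n + m, l + 1))) i c =
    k.+1%:R * ((i == c :> nat) && (i < n)%N)%:R + (c == i.+1 :> nat)%:R.
  rewrite mxE (bigD1 (widen_ord ln1 c))//= pencil_witness !mxE/= eqxx ltn_ord.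
  rewrite mulr1 big1 ?addr0// => d dc.
  rewrite !mxE; case: eqP => [e|_]; last by rewrite mulr0.
  by case/eqP: dc; apply/val_inj.
rewrite mxE (bigD1 a)//= (bigD1 b) /=; last first.
  by apply/eqP => /(congr1 val) /eqP /=; rewrite ai bi gtn_eqF.
rewrite !colE ai bi !eqxx /= addrA big1 => [|c /andP[ca cb]].
  by rewrite [i == i.+1 :> nat]ltn_eqF//= !mulr0 add0r !addr0 mul1r.
rewrite colE; case: eqP => [e|_].
  by case/eqP: ca; apply/val_inj; rewrite /= ai.
case: eqP => [e|_]; first by case/eqP: cb; apply/val_inj; rewrite /= bi.
by rewrite mulr0 add0r mul0r.
Qed.

Lemma bordered_last (E A : 'M[R]_(l, n)) (B : 'M[R]_(l, m)) k
    (v : 'cV[R]_(l + 1)) (a : 'I_(l + 1)) : a = 0%N :> nat ->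
  (bordered_pencil E A B k *m v) (rshift l 0) 0 = v a 0.
Proof.
move=> a0; rewrite mul_col_mx col_mxEd mxE (bigD1 a)//= big1 => [|b ba].
  by rewrite !mxE a0 /= mul1r addr0.
rewrite !mxE /=; case: eqP => [e|_]; last by rewrite mul0r.
by case/eqP: ba; apply/val_inj; rewrite /= a0.
Qed.

Definition witness_kernel k : 'cV[R]_(l + 1) :=
  \col_(i < l + 1) (if (i <= n)%N then (- k.+1%:R) ^+ i else 0).

Lemma bordered_witness_kernel k :
  bordered_pencil witness_E witness_A witness_B k *m witness_kernel k =
  delta_mx (rshift l 0) 0.
Proof.
have l1 : (0 < l + 1)%N by rewrite addn1.
apply/colP => j; case: (split_ordP j) => i ->; last first.
  rewrite !ord1 (@bordered_last _ _ _ _ _ (Ordinal l1))// !mxE /=.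
  by rewrite !eqxx.
have il : (i.+1 < l + 1)%N by rewrite addn1 ltnS.
rewrite mul_col_mx col_mxEu (@pencil_witness_mul _ _ _ (lshift 1 i) (Ordinal il))//.
rewrite !mxE /= eq_lrshift /=; case: (ltnP i n) => [lin|nli].
  by rewrite (ltnW lin) exprS mulr1 mulNr subrr.
by rewrite mulr0 mul0r addr0.
Qed.

(** The last row forces a kernel vector to start with 0, and the superdiagonal ones propagate this
    zero from each entry to the next. *)
Lemma det_bordered_witness k :
  \det (bordered_pencil witness_E witness_A witness_B k) != 0.
Proof.
rewrite -det_tr; apply/det0P => -[w w0 Gw].
have {}Gw : bordered_pencil witness_E witness_A witness_B k *m w^T = 0.
  by apply: trmx_inj; rewrite trmx_mul trmxK Gw trmx0.
case/eqP: w0; apply: trmx_inj; rewrite trmx0.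
suff H d (a : 'I_(l + 1)) : a = d :> nat -> w^T a 0 = 0.
  by apply/colP => a; rewrite (H a)// !mxE.
elim: d a => [|d IH] a ad.
  by rewrite -(@bordered_last witness_E witness_A witness_B k _ _ ad) Gw mxE.
have dl : (d < l)%N by rewrite -ltnS -addn1 -ad addn1 -(addn1 l) ltn_ord.
have := congr1 (fun M : 'cV[R]_(l + 1) => M (lshift 1 (Ordinal dl)) 0) Gw.
rewrite mul_col_mx col_mxEu (@pencil_witness_mul _ _ _ (lshift 1 (Ordinal dl)) a)//.
by rewrite (IH (lshift 1 (Ordinal dl)))// mulr0 add0r => ->; rewrite mxE.
Qed.

(** Cramer's rule: apply the adjugate to [bordered_witness_kernel]. *)
Lemma pencil_kernel_witness k :
  pencil_kernel witness_E witness_A witness_B k =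
  \det (bordered_pencil witness_E witness_A witness_B k) *:
    (pid_mx (l + 1) *m witness_kernel k).
Proof.
rewrite /pencil_kernel -(bordered_witness_kernel k).
by rewrite [\adj _ *m (_ *m _)]mulmxA mul_adj_mx mul_scalar_mx -scalemxAr.
Qed.

Lemma criterion_witness : criterion witness_E witness_A witness_B != 0.
Proof.
set r := minn l n.
pose V := Vandermonde r (\row_(k < r) (- k.+1%:R) : 'rV[R]_r).
pose D := diag_mx (\row_(k < r)
  \det (bordered_pencil witness_E witness_A witness_B k)).
(* [witness_E] keeps the leading [minn l n] entries of each kernel vector: column [k] lists powers
   of [- k.+1], scaled by the determinant of its bordered pencil. *)
have -> : criterion witness_E witness_A witness_B = \det (V *m D).
  congr (\det _); apply/matrixP => i k.
  have il : (i < l)%N by rewrite (leq_trans (ltn_ord i)) ?geq_minl.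
  have in_ : (i < n)%N by rewrite (leq_trans (ltn_ord i)) ?geq_minr.
  have inm : (i < n + m)%N by rewrite ltn_addr.
  have il1 : (i < l + 1)%N by rewrite ltn_addr.
  rewrite -mulmxA (@mul_pid_mxE _ _ _ _ _ _ i k (Ordinal il))//.
  rewrite (@mul_pid_mxE _ _ _ _ _ _ (Ordinal il) k (Ordinal in_))// mul_mx_diag.
  rewrite [LHS]mxE pencil_kernel_witness [LHS]mxE [LHS]mxE mulrC.
  rewrite (@mul_pid_mxE _ _ _ _ _ _ (lshift m (Ordinal in_)) 0 (Ordinal il1))//.
  by rewrite !mxE /= ltnW.
rewrite det_mulmx mulf_neq0//.
  rewrite det_Vandermonde; apply/prodf_neq0 => i _; apply/prodf_neq0 => j ij.
  rewrite !mxE subr_eq0 eqr_opp eqr_nat eqSS.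
  by rewrite gtn_eqF.
rewrite det_diag; apply/prodf_neq0 => i _; rewrite mxE.
exact: det_bordered_witness.
Qed.

End Witness.

(** * Polynomials in the matrix entries and proper varieties *)

Definition vec_Sigma (T : Type) (l n m : nat)
    (v : 'rV[T]_(l * n + l * n + l * m)) :
    'M[T]_(l, n) * 'M[T]_(l, n) * 'M[T]_(l, m) :=
  (vec_mx (lsubmx (lsubmx v)), vec_mx (rsubmx (lsubmx v)), vec_mx (rsubmx v)).

Lemma Sigma_vecK (R : realType) (l n m : nat) :
  cancel (@Sigma_vec R l n m) (@vec_Sigma R l n m).
Proof.
by case=> [[E A] B]; rewrite /vec_Sigma /Sigma_vec !(row_mxKl, row_mxKr, mxvecK).
Qed.

Lemma vec_SigmaK (R : realType) (l n m : nat) :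
  cancel (@vec_Sigma R l n m) (@Sigma_vec R l n m).
Proof. by move=> v; rewrite /Sigma_vec !vec_mxK !hsubmxK. Qed.

Lemma criterion_mpoly (R : realType) (l n m : nat) :
  exists p : mpoly.mpoly (l * n + l * n + l * m) R,
  forall v : 'rV[R]_(l * n + l * n + l * m),
  mpoly.meval (fun j => v 0 j) p =
  criterion (vec_Sigma v).1.1 (vec_Sigma v).1.2 (vec_Sigma v).2.
Proof.
pose X : 'rV[mpoly.mpoly (l * n + l * n + l * m) R]_(l * n + l * n + l * m) :=
  \row_i mpoly.mpolyX R (mpoly.mnm1 i).
exists (criterion (vec_Sigma X).1.1 (vec_Sigma X).1.2 (vec_Sigma X).2) => v.
rewrite -map_criterion /= !map_vec_mx !(map_lsubmx, map_rsubmx).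
suff -> : map_mx (mpoly.meval (fun j => v 0 j)) X = v by [].
by apply/rowP => i; rewrite !mxE mpoly.mevalXU.
Qed.

Lemma generic_of_criterion (R : realType) (l n m : nat) (P : set (Sigma R l n m)) :
  (l < n + m)%N ->
  (forall E A B, criterion E A B != 0 -> P (E, A, B)) ->
  generic (@Sigma_vec R l n m @` P).
Proof.
move=> ln critP; have [p pE] := criterion_mpoly R l n m.
exists [set v | mpoly.meval (fun j => v 0 j) p = 0]; split.
- exists 1%N, (fun=> p); apply/seteqP; split=> v //= H; exact: (H ord0).
(* The witness lies off the zero set, which is therefore proper. *)
- pose w := Sigma_vec (witness_E R l n, witness_A R l n, witness_B R l n m).
  move=> /(congr1 (fun V => V w)) /=.
  rewrite pE Sigma_vecK /= => H.
  by have /eqP := @criterion_witness R l n m ln; apply; rewrite H.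
move=> v; apply: contra_notP; rewrite /= pE => /eqP/critP cv.
by exists (vec_Sigma v); [rewrite -!surjective_pairing in cv *|exact: vec_SigmaK].
Qed.

Definition line (R : realType) (N : nat) (v w : 'rV[R]_N) (t : R) : 'rV[R]_N :=
  v + t *: (w - v).

Lemma meval_line (R : realType) (N : nat) (p : mpoly.mpoly N R) (v w : 'rV[R]_N) :
  exists P : {poly R}, forall t,
    P.[t] = mpoly.meval (fun j => line v w t 0 j) p.
Proof.
exists (mpoly.mmap polyC (fun j => (v 0 j)%:P + 'X * (w 0 j - v 0 j)%:P) p) => t.
rewrite /mpoly.mmap /mpoly.meval /mpoly.mmap horner_sum; apply: eq_bigr => a _.
rewrite /mpoly.mmap1 hornerM hornerC horner_prod; congr (_ * _).
by apply: eq_bigr => j _; rewrite horner_exp !hornerE !mxE.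
Qed.

Lemma poly_nonroot_small (R : realFieldType) (p : {poly R}) (d : R) :
  p != 0 -> 0 < d -> exists2 t, 0 < t < d & p.[t] != 0.
Proof.
move=> p0 d0.
(* As many distinct points as [size p], hence more than a nonzero [p] has roots; [k.+2] keeps them
   strictly below [d]. *)
pose rs : seq R := [seq d / k.+2%:R | k <- iota 0 (size p)].
have [/allP H|/allPn[t /mapP[k _ ->] tp]] := boolP (all (root p) rs).
  have : (size rs < size p)%N.
    apply: max_poly_roots => //; first exact/allP.
    rewrite map_inj_uniq ?iota_uniq// => i j.
    move=> /(mulfI (lt0r_neq0 d0))/invr_inj/eqP; rewrite eqr_nat.
    by case/eqP.
  by rewrite size_map size_iota ltnn.
exists (d / k.+2%:R); last exact: tp.
by rewrite divr_gt0//= ltr_pdivrMr// ltr_pMr// ltr1n.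
Qed.

(* [w] is any point off the proper variety: one of the defining polynomials
   restricts to a nonzero univariate polynomial on the line through [v] and
   [w]. *)
Lemma generic_near (R : realType) (N : nat) (S : set 'rV[R]_N) (v : 'rV[R]_N) :
  generic S -> exists w, forall d, 0 < d ->
  exists2 t, 0 < t < d & S (line v w t).
Proof.
move=> [V [[k [p ->]] VT SV]].
have [w wV] : exists w : 'rV[R]_N,
    ~ (forall i, mpoly.meval (fun j => w 0 j) (p i) = 0).
  apply/existsNP => H; apply: VT; apply/seteqP; split => // w _; exact: H w.
have /existsNP[i pi0] := wV.
have [P PE] := meval_line (p i) v w.
(* At [t = 1] the line passes through [w], where [p i] is nonzero. *)
have P0 : P != 0.
  apply/eqP => P0; apply: pi0; have := PE 1.
  rewrite P0 horner0 => ->; apply: mpoly.meval_eq => j.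
  by rewrite /line scale1r addrC subrK.
exists w => d d0; have [t td Pt] := poly_nonroot_small P0 d0.
exists t => //; apply: contrapT => /SV /= /(_ i) H.
by rewrite PE H eqxx in Pt.
Qed.

(** * Exponential solutions *)

Lemma mx_norm_le (R : realType) (p q : nat) (M : 'M[R]_(p, q)) (K : R) :
  0 <= K -> (forall i j, `|M i j| <= K) -> `|M| <= K.
Proof.
move=> K0 MK; rewrite [leLHS]/Num.Def.normr/= mx_normrE.
by rewrite (bigmax_le _ K0)//= => -[i j] _; exact: MK.
Qed.

Lemma le_mx_norm (R : realType) (p q : nat) (M : 'M[R]_(p, q)) i j :
  `|M i j| <= `|M|.
Proof.
by rewrite [leRHS]/Num.Def.normr/= mx_normrE; exact: (le_bigmax _ _ (i, j)).
Qed.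

Lemma is_derive_mxP (R : realType) (p q : nat) (M : R -> 'M[R]_(p, q)) (t v : R)
    (dM : 'M[R]_(p, q)) :
  is_derive t v M dM <-> forall i j, is_derive t v (fun s => M s i j) (dM i j).
Proof.
split=> [[dv <-] i j|H].
  by rewrite derive_mx// mxE; apply/derivableP; move/derivable_mxP : dv; exact.
have dv : derivable M t v by apply/derivable_mxP => i j; have [] := H i j.
split=> //; rewrite derive_mx//; apply/matrixP => i j; rewrite mxE.
by have [_ ->] := H i j.
Qed.

Lemma is_derive_mulmx (R : realType) (p q r : nat) (M : 'M[R]_(p, q))
    (y : R -> 'M[R]_(q, r)) (t v : R) (dy : 'M[R]_(q, r)) :
  is_derive t v y dy -> is_derive t v (fun s => M *m y s) (M *m dy).
Proof.
move=> /is_derive_mxP Dy; apply/is_derive_mxP => i j.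
have -> : (fun s => (M *m y s) i j) = \sum_(k < q) (fun s => M i k * y s k j).
  by apply/funext => s; rewrite mxE fct_sumE.
by rewrite mxE; apply: is_derive_sum => k; exact: is_deriveZ.
Qed.

Lemma continuous_locally_integrable (R : realType) (f : R -> R) :
  continuous f -> locally_integrable setT f.
Proof.
move=> cf; split; [exact: continuous_measurable_fun|exact: openT|].
move=> K _ cK.
have /(continuous_compact_integrable cK)/integrableP[] // :
  {within K, continuous f} by exact: continuous_subspaceT.
Qed.

Lemma lipschitz_loc_abs_continuous (R : realType) (V : normedModType R)
    (f : R -> V) :
  (forall a b, exists K, forall s t, a <= s -> s <= t -> t <= b ->
    `|f t - f s| <= K * (t - s)) ->
  loc_abs_continuous f.
Proof.
move=> fK a b ab e e0; have [K KP] := fK a b.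
have K10 : 0 < `|K| + 1 by rewrite ltr_wpDl.
exists (e / (`|K| + 1)); first exact: divr_gt0.
move=> k s t st _; rewrite ltr_pdivlMr// mulrC; apply: le_lt_trans.
rewrite mulr_sumr; apply: ler_sum => i _; have [asi sti tib] := st i.
apply: (le_trans (KP _ _ asi sti tib)).
by rewrite ler_wpM2r ?subr_ge0// (le_trans (ler_norm K))// lerDl.
Qed.

Section Modes.
Variables (R : realType) (r : nat) (c : 'cV[R]_r).

(** State, input and [E x] of the solution to be built all have the form [M *m modes t], hence the
    lemmas for arbitrary [M]. *)
Definition modes (t : R) : 'cV[R]_r := \col_k (c k 0 * expR (- k.+1%:R * t)).

Definition mode_rates : 'M[R]_r := diag_mx (\row_k - k.+1%:R).

Lemma modes0 : modes 0 = c.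
Proof. by apply/colP => k; rewrite mxE mulr0 expR0 mulr1. Qed.

Lemma is_derive_modes p (M : 'M[R]_(p, r)) (t : R) :
  is_derive t 1 (fun s => M *m modes s) (M *m (mode_rates *m modes t)).
Proof.
apply: is_derive_mulmx; apply/is_derive_mxP => k j.
have -> : (fun s => modes s k j) = (fun s => c k 0 * expR (- k.+1%:R * s)).
  by apply/funext => s; rewrite mxE.
apply: is_derive_eq.
rewrite mul_diag_mx !mxE [LHS]mulrA [LHS]mulrC.
by congr (_ * _); rewrite [LHS]mulr1.
Qed.

Lemma mul_modes_continuous p (M : 'M[R]_(p, r)) i :
  continuous (fun t => (M *m modes t) i 0).
Proof.
move=> t; apply/differentiable_continuous/derivable1_diffP.
by have /is_derive_mxP/(_ i 0)[] := is_derive_modes M t.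
Qed.

Lemma mul_modes_L1loc p (M : 'M[R]_(p, r)) : L1loc (fun t => M *m modes t).
Proof.
move=> i; exists (fun t => (M *m modes t) i 0); last exact: aeW.
exact/continuous_locally_integrable/mul_modes_continuous.
Qed.

(** Factor out [expR (- b * s)], at most [expR (- b * a)], and use [1 - h <= expR (- h)] with
    [h = b * (t - s)]. *)
Lemma expR_diff_le (a b s t : R) : 0 <= b -> a <= s -> s <= t ->
  `|expR (- b * t) - expR (- b * s)| <= expR (- b * a) * (b * (t - s)).
Proof.
move=> b0 as_ st.
have -> : - b * t = - b * s + - (b * (t - s)) by ring.
rewrite expRD -[X in _ - X]mulr1 -mulrBr normrM ger0_norm ?expR_ge0//.
have bts : 0 <= b * (t - s) by rewrite mulr_ge0// subr_ge0.
apply: ler_pM; rewrite ?expR_ge0//.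
  by rewrite ler_expR ler_wnM2l// oppr_le0.
rewrite distrC ger0_norm; last by rewrite subr_ge0 -expR0 ler_expR oppr_le0.
have := expR_ge1Dx (- (b * (t - s))); lra.
Qed.

Lemma mul_modes_loc_abs_continuous p (M : 'M[R]_(p, r)) :
  loc_abs_continuous (fun t => M *m modes t).
Proof.
apply: lipschitz_loc_abs_continuous => a b.
(* A Lipschitz constant on all of [[a, +oo[]; summing over every row [i] bounds the max norm. *)
pose K := \sum_i \sum_k `|M i k * c k 0| * (expR (- k.+1%:R * a) * k.+1%:R).
have K0 i k : 0 <= `|M i k * c k 0| * (expR (- k.+1%:R * a) * k.+1%:R).
  by rewrite !mulr_ge0 ?expR_ge0.
exists K => s t as_ st _; rewrite -mulmxBr; apply: mx_norm_le => [|i j].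
  rewrite mulr_ge0 ?subr_ge0//.
  by apply: sumr_ge0 => i _; apply: sumr_ge0 => k _; exact: K0.
apply: (@le_trans _ _ ((\sum_k `|M i k * c k 0| *
    (expR (- k.+1%:R * a) * k.+1%:R)) * (t - s))).
  rewrite mxE mulr_suml; apply: (le_trans (ler_norm_sum _ _ _)).
  apply: ler_sum => k _; rewrite !mxE -mulrBr mulrA normrM -!mulrA.
  by rewrite ler_wpM2l// expR_diff_le.
rewrite ler_wpM2r ?subr_ge0// /K (bigD1 i)//= lerDl.
by apply: sumr_ge0 => i' _; apply: sumr_ge0 => k _; exact: K0.
Qed.

(** Every mode decays at least like [expR (- t)] for [t > 0], and [K * expR (- t) <= e] once
    [t > K / e], because [1 + t <= expR t]. *)
Lemma mul_modes_cvg0 p (M : 'M[R]_(p, r)) :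
  M *m modes t @[t --> +oo] --> (0 : 'cV[R]_p).
Proof.
pose K := \sum_i \sum_k `|M i k * c k 0|.
have K0 : 0 <= K by apply: sumr_ge0 => i _; apply: sumr_ge0 => k _.
apply/cvgrPdist_le => /= e e0.
have Ke : 0 <= K / e by rewrite divr_ge0// ltW.
near=> t.
have t0 : 0 < t.
  by apply: (le_lt_trans Ke); near: t; apply: nbhs_pinfty_gt; rewrite num_real.
rewrite sub0r normrN; apply: (@le_trans _ _ (K * expR (- t))).
  apply: mx_norm_le => [|i j]; first by rewrite mulr_ge0 ?expR_ge0.
  apply: (@le_trans _ _ ((\sum_k `|M i k * c k 0|) * expR (- t))).
    rewrite mxE mulr_suml; apply: (le_trans (ler_norm_sum _ _ _)).
    apply: ler_sum => k _; rewrite !mxE mulrA normrM.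
    rewrite ler_wpM2l// ger0_norm ?expR_ge0// ler_expR mulNr lerN2.
    by rewrite ler_peMl ?(ltW t0)// ler1n.
  rewrite ler_wpM2r ?expR_ge0// /K (bigD1 i)//= lerDl.
  by apply: sumr_ge0 => i' _; apply: sumr_ge0.
rewrite expRN ler_pdivrMr ?expR_gt0//.
have Kt : K < t * e.
  by rewrite -ltr_pdivrMr//; near: t; apply: nbhs_pinfty_gt; rewrite num_real.
apply: (le_trans (ltW Kt)); rewrite mulrC ler_pM2l//.
by have := expR_ge1Dx t; lra.
Unshelve. all: by end_near. Qed.

End Modes.

Lemma criterion_strongly_stabilizable (R : realType) (l n m : nat)
    (E A : 'M[R]_(l, n)) (B : 'M[R]_(l, m)) :
  criterion E A B != 0 -> strongly_stabilizable E A B.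
Proof.
set r := minn l n => crit x0.
pose X := kernel_states E A B r.
pose U : 'M[R]_(m, r) := \matrix_(i, k) dsubmx (pencil_kernel E A B k) i 0.
(* Column [k] is [pencil_kernelP] split into state and input parts. *)
have eqX : E *m X *m mode_rates R r = A *m X + B *m U.
  apply/matrixP => i k.
  have Xk : col k X = usubmx (pencil_kernel E A B k).
    by apply/colP => j; rewrite !mxE.
  have Uk : col k U = dsubmx (pencil_kernel E A B k).
    by apply/colP => j; rewrite !mxE.
  have := congr1 (fun M : 'cV[R]_l => M i 0) (pencil_kernelP E A B k).
  rewrite -[pencil_kernel _ _ _ _]vsubmxK mul_row_col mulmxDl -scalemxAl -Xk -Uk.
  rewrite !colE !mulmxA -!colE mul_mx_diag.
  move: (E *m X) (A *m X) (B *m U) => P Q W; rewrite !mxE => H.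
  have -> : W i k = - (k.+1%:R * P i k + Q i k).
    by apply/eqP; rewrite -addr_eq0 addrC; apply/eqP.
  by rewrite opprD addrCA subrr addr0 mulrN mulrC.
(* The range of [E *m X] lies in that of [E] and has rank at least [r], so the two coincide;
   transposes appear because [submx] compares row spaces. *)
have [c Ec] : exists c : 'cV[R]_r, E *m x0 = E *m X *m c.
  have rkZ : \rank (pid_mx r *m E *m X : 'M[R]_(r, r)) = r.
    by apply/mxrank_unit; rewrite unitmxE unitfE.
  have rkEX : (r <= \rank (E *m X))%N.
    by rewrite -{1}rkZ -mulmxA mxrankM_maxr.
  have sub : (E^T <= (E *m X)^T)%MS.
    have := mxrank_leqif_sup (submxMl X^T E^T).
    rewrite -trmx_mul => -[_ <-]; rewrite !mxrank_tr eqn_leq.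
    by rewrite mxrankM_maxl (leq_trans _ rkEX)// leq_min rank_leq_row rank_leq_col.
  have /submxP[D Dx] : (x0^T *m E^T <= (E *m X)^T)%MS.
    exact: submx_trans (submxMl _ _) sub.
  by exists D^T; apply: trmx_inj; rewrite !trmx_mul Dx trmxK -!trmx_mul.
exists ((fun t => X *m modes c t), (fun t => U *m modes c t)).
have Ef : (fun t => E *m (X *m modes c t)) = (fun t => E *m X *m modes c t).
  by apply/funext => t; rewrite mulmxA.
split => /=; [split => /=|by rewrite modes0 mulmxA Ec|].
- exact: mul_modes_L1loc.
- exact: mul_modes_L1loc.
- by rewrite Ef; exact: mul_modes_loc_abs_continuous.
- apply: aeW => t; rewrite Ef !mulmxA -mulmxDl -eqX -mulmxA.
  exact: is_derive_modes.
- by rewrite Ef; exact: mul_modes_cvg0.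
Qed.

(** * Monotonicity of absolutely continuous functions *)

Lemma sum_itv_lengths_le (R : realType) (k : nat) (s t : 'I_k -> R) (U : set R) :
  measurable U -> (forall i, s i <= t i) ->
  trivIset setT (fun i => `]s i, t i[%classic) ->
  (forall i, `]s i, t i[%classic `<=` U) ->
  ((\sum_(i < k) (t i - s i))%:E <= lebesgue_measure U)%E.
Proof.
move=> mU st tr sU; rewrite -sumEFin.
have lenE i : ((t i - s i)%:E = lebesgue_measure (`]s i, t i[%classic : set R))%E.
  rewrite lebesgue_measure_itv /= lte_fin EFinD.
  have := st i; rewrite le_eqVlt => /predU1P[->|->//].
  by rewrite ltxx -EFinB subrr.
rewrite (eq_bigr _ (fun i _ => lenE i)) -measure_semi_additive_ord//=; last first.
  by apply: bigsetU_measurable.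
apply: le_measure; rewrite ?inE//=; first exact: bigsetU_measurable.
apply: (big_ind (fun A => A `<=` U)) => //.
by move=> A B AU BU; rewrite subUset.
Qed.

(** Outer regularity of a measurable null set containing [N]. *)
Lemma negligible_open_cover (R : realType) (N : set R) (d : R) :
  (@lebesgue_measure R).-negligible N -> 0 < d ->
  exists U, [/\ open U, N `<=` U & (lebesgue_measure U < d%:E)%E].
Proof.
move=> [A [mA A0 NA]] d0.
have [|U [oU AU UA]] := @lebesgue_regularity_outer R A d mA _ d0.
  by rewrite [ltLHS]A0 ltry.
exists U; split=> //; first exact: subset_trans NA AU.
have mU := open_measurable oU.
have := measureDI (@lebesgue_measure R) mU mA.
have -> : U `&` A = A by apply/setIidr.
by rewrite [X in (_ + X)%E]A0 adde0 => ->.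
Qed.

(** Near [x] the difference quotient is at least [- e]. Both sides matter: a chain must reach [x]
    from the left and leave it to the right. *)
Lemma is_derive_ge0_near (R : realType) (f : R -> R) (x df e : R) :
  is_derive x 1 f df -> 0 <= df -> 0 < e ->
  exists2 d, 0 < d & forall u, `|u - x| < d ->
    (x <= u -> f x - f u <= e * (u - x)) /\
    (u <= x -> f u - f x <= e * (x - u)).
Proof.
move=> [fx dfx] df0 e0; rewrite -dfx in df0.
have /cvgrPdist_le /(_ _ e0) [d /= d0 H] :=
  (fx : h^-1 *: (f (h *: 1 + x) - f x) @[h --> 0^'] --> 'D_1 f x).
exists d => // u uxd.
have [->|ux] := eqVneq u x; first by rewrite !subrr mulr0.
have h0 : u - x != 0 by rewrite subr_eq0.
have := H (u - x); rewrite /ball_/= sub0r normrN => /(_ uxd h0).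
rewrite /GRing.scale/= mulr1 subrK ler_distlC => /andP[H1 _].
have {}H1 : - e <= (u - x)^-1 * (f u - f x) by apply: le_trans H1; lra.
split=> [xu|xu].
  have ux0 : 0 < u - x by rewrite subr_gt0 lt_neqAle eq_sym ux.
  by move: H1; rewrite mulrC ler_pdivlMr//; lra.
have ux0 : u - x < 0 by rewrite subr_lt0 lt_neqAle ux.
by move: H1; rewrite mulrC ler_ndivlMr//; lra.
Qed.

(* Either a point has a nonnegative derivative, and then [f] decreases at rate
   at most [e] near it, or it lies in the small open set [U], whose
   contribution is controlled by absolute continuity; [chain] records how far
   such an estimate can be propagated from [a]. *)
Definition chain (R : realType) (f : R -> R) (U : set R) (e a c : R) : Prop :=
  exists (k : nat) (s t : 'I_k -> R),
  [/\ forall i, [/\ a <= s i, s i <= t i & t i <= c],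
      trivIset setT (fun i => `]s i, t i[%classic),
      forall i, `]s i, t i[%classic `<=` U &
      f a - f c <= e * (c - a) + \sum_(i < k) `|f (t i) - f (s i)|].

Section Chain.
Variables (R : realType) (f : R -> R) (U : set R) (e a : R).

Lemma chain_refl : chain f U e a a.
Proof.
have F (i : 'I_0) : False by case: i.
exists 0%N, (fun _ => 0), (fun _ => 0).
split; [by move=> i; case: (F i)|by move=> i; case: (F i)|
  by move=> i; case: (F i)|].
by rewrite !subrr mulr0 big_ord0 addr0.
Qed.

Lemma chain_step c c' : chain f U e a c -> c <= c' ->
  f c - f c' <= e * (c' - c) -> chain f U e a c'.
Proof.
move=> [k [s [t [H1 H2 H3 H4]]]] cc' fcc'; exists k, s, t; split => //.
  by move=> i; have [? ? tc] := H1 i; split => //; exact: le_trans tc cc'.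
have : f a - f c + (f c - f c') <= e * (c - a) +
  (\sum_(i < k) `|f (t i) - f (s i)|) + e * (c' - c) by exact: lerD.
lra.
Qed.

Lemma chain_open c c' : a <= c -> chain f U e a c -> c <= c' -> 0 <= e ->
  `]c, c'[%classic `<=` U -> chain f U e a c'.
Proof.
move=> ac [k [s [t [H1 H2 H3 H4]]]] cc' e0 cU.
pose ext (g : 'I_k -> R) x (i : 'I_k.+1) := oapp g x (unlift ord0 i).
exists k.+1, (ext s c), (ext t c'); split.
- move=> i; rewrite /ext; case: unliftP => [j _|_] /=; last by split.
  by have [? ? tc] := H1 j; split => //; exact: le_trans tc cc'.
(* The added interval starts at [c], where all the earlier ones have ended. *)
- move=> i j _ _; rewrite /ext.
  case: unliftP => [i' ->|->]; case: unliftP => [j' ->|->] //=.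
  + by move=> /(H2 _ _ I I) ->.
  + move=> [x [/=]]; rewrite !in_itv /= => /andP[_ xt] /andP[cx _].
    have [_ _ tc] := H1 i'.
    by have := lt_trans cx (lt_le_trans xt tc); rewrite ltxx.
  + move=> [x [/=]]; rewrite !in_itv /= => /andP[cx _] /andP[_ xt].
    have [_ _ tc] := H1 j'.
    by have := lt_trans cx (lt_le_trans xt tc); rewrite ltxx.
- by move=> i; rewrite /ext; case: unliftP => [j _|_] /=; [exact: H3|exact: cU].
rewrite big_ord_recl /ext unlift_none /=.
under eq_bigr do rewrite liftK /=.
have := ler_norm (f c - f c'); rewrite distrC.
have := ler_wpM2l e0 cc'; lra.
Qed.

(** Real induction: the supremum of the reachable points is reachable from points just to its left,
    and if it were below [b] it could be passed. *)
Lemma chain_total b : a <= b -> 0 <= e ->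
  (forall x, a <= x <= b -> exists2 d, 0 < d & forall u, `|u - x| < d ->
    (u <= x -> a <= u -> chain f U e a u -> chain f U e a x) /\
    (x <= u -> chain f U e a x -> chain f U e a u)) ->
  chain f U e a b.
Proof.
move=> ab e0 loc.
pose C := [set c | a <= c <= b /\ chain f U e a c].
have Ca : C a by split; [rewrite lexx ab|exact: chain_refl].
have Cb : ubound C b by move=> c [/andP[_]].
have supC : has_sup C by split; [exists a|exists b].
have s_ab : a <= sup C <= b.
  apply/andP; split; first by apply: ub_le_sup => //; exists b.
  by apply: ge_sup => //; exists a.
have [d d0 H] := loc _ s_ab.
have [u [/andP[au ub] Cu] us] := sup_adherent d0 supC.
have us' : u <= sup C by apply: ub_le_sup; [exists b|split => //; rewrite au].
have Cs : chain f U e a (sup C).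
  have [|/(_ us' au Cu) //] := H u.
  by rewrite distrC ger0_norm ?subr_ge0//; lra.
have [sb|sb] := ltP (sup C) b; last first.
  by have -> : b = sup C by apply/eqP; rewrite eq_le sb; case/andP: s_ab.
pose v := Num.min b (sup C + d / 2).
have sv : sup C < v by rewrite lt_min sb ltrDl divr_gt0.
have [|_ /(_ (ltW sv) Cs) Cv] := H v.
  rewrite ger0_norm ?subr_ge0 ?(ltW sv)//.
  have : v <= sup C + d / 2 by rewrite ge_min lexx orbT.
  have := d0; lra.
have : v <= sup C.
  apply: ub_le_sup; first by exists b.
  split=> //; apply/andP; split; last by rewrite ge_min lexx.
  by case/andP: s_ab => as_ _; exact: le_trans as_ (ltW sv).
by rewrite leNgt sv.
Qed.

End Chain.

Lemma abs_continuous_nondecreasing (R : realType) (f : R -> R) (a b : R) :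
  a <= b -> abs_continuous_on a b f ->
  {ae (@lebesgue_measure R), forall t : R,
    exists2 df : R, 0 <= df & is_derive t (1 : R) f df} ->
  f a <= f b.
Proof.
move=> ab acf aef.
(* The term [e * (b - a)] pays for points with a nonnegative derivative, the last [e] for the
   variation of [f] inside [U]. *)
suff H e : 0 < e -> f a - f b <= e * (b - a) + e.
  rewrite -subr_le0; apply/ler_addgt0Pl => e e0; rewrite addr0.
  have K0 : 0 < b - a + 1 by rewrite ltr_wpDl// subr_ge0.
  have := H (e / (b - a + 1)) (divr_gt0 e0 K0).
  by rewrite -[X in _ * _ + X]mulr1 -mulrDr divfK// gt_eqF.
move=> e0; have [d d0 acd] := acf e e0.
have [U [oU NU Ud]] := negligible_open_cover aef d0.
have [k [s [t [H1 H2 H3 H4]]]] : chain f U e a b.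
  apply: chain_total => //; first exact: ltW.
  move=> x /andP[ax xb].
  have [[df df0 fx]|Nx] :=
      pselect (exists2 df : R, 0 <= df & is_derive x (1 : R) f df).
    have [r r0 H] := is_derive_ge0_near fx df0 e0.
    exists r => // u uxr; have [Hr Hl] := H _ uxr.
    split=> [ux au Cu|xu Cx]; first exact: (chain_step Cu ux (Hl ux)).
    exact: (chain_step Cx xu (Hr xu)).
  have Ux : U x by exact: NU.
  have /= [r /= r0 rU] := (open_subball oU Ux).
  exists (r / 2) => [|u uxr]; first exact: divr_gt0.
  have xU y : `|y - x| < r / 2 -> U y.
    move=> yx; apply: (rU (r / 2)) => /=; last by rewrite -ball_normE /= distrC.
      by rewrite sub0r normrN ger0_norm; lra.
    exact: divr_gt0.
  split=> [ux au Cu|xu Cx].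
    apply: (chain_open au Cu ux (ltW e0)) => y /=; rewrite in_itv/= => /andP[uy yx].
    by apply: xU; move: uxr; rewrite !ltr_norml; lra.
  apply: (chain_open ax Cx xu (ltW e0)) => y /=; rewrite in_itv/= => /andP[xy yu].
  by apply: xU; move: uxr; rewrite !ltr_norml; lra.
apply: (le_trans H4); rewrite lerD2l ltW//; apply: acd => //.
rewrite -lte_fin; apply: (le_lt_trans _ Ud).
apply: sum_itv_lengths_le => //; first exact: open_measurable.
by move=> i; have [] := H1 i.
Qed.

(** * Systems that are robustly not stabilizable *)

(** Absolute continuity on [[x - 1, x + 1]] for families of one interval. *)
Lemma loc_abs_continuous_continuous (R : realType) (V : normedModType R)
    (y : R -> V) : loc_abs_continuous y -> continuous y.
Proof.
move=> acy x; apply/cvgrPdist_lt => e e0.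
have [|d d0 H] := acy (x - 1) (x + 1) _ e e0; first lra.
have near_x s t : s <= t -> x - 1 <= s -> t <= x + 1 -> t - s < d ->
    `|y t - y s| < e.
  move=> st xs tx tsd.
  have := H 1%N (fun=> s) (fun=> t); rewrite !big_ord1; apply => //.
  by move=> i j _ _ _; rewrite !ord1.
near=> z.
have zd : `|x - z| < d by near: z; exact: cvgr_dist_lt.
have z1 : `|x - z| < 1 by near: z; exact: cvgr_dist_lt.
move: zd z1; rewrite !ltr_norml => /andP[zd1 zd2] /andP[z11 z12].
have [xz|zx] := leP x z; last by apply: near_x; lra.
by rewrite distrC; apply: near_x; lra.
Unshelve. all: by end_near. Qed.

Section SquareNorm.
Variables (R : realType) (p q : nat) (M : 'M[R]_(p, q)).

(** The squared Euclidean norm of [M *m v], differentiable in [v], unlike the square of the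
    library's max norm. *)
Definition sqnorm_mul (v : 'cV[R]_q) : R := \sum_(j < p) (M *m v) j 0 ^+ 2.

Lemma sqnorm_mul_ge0 v : 0 <= sqnorm_mul v.
Proof. by apply: sumr_ge0 => j _; exact: sqr_ge0. Qed.

(** Coordinatewise, a difference of squares is a difference times a sum, and [M] is bounded. *)
Lemma sqnorm_mul_dist : exists2 C, 0 < C & forall v w,
  `|sqnorm_mul v - sqnorm_mul w| <= C * `|v - w| * (`|v| + `|w|).
Proof.
pose c := \sum_j \sum_k `|M j k|.
have c0 : 0 <= c by apply: sumr_ge0 => j _; exact: sumr_ge0.
have Mc v j : `|(M *m v) j 0| <= c * `|v|.
  rewrite mxE; apply: (le_trans (ler_norm_sum _ _ _)).
  apply: (@le_trans _ _ ((\sum_k `|M j k|) * `|v|)).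
    rewrite mulr_suml; apply: ler_sum => k _.
    by rewrite normrM ler_wpM2l// le_mx_norm.
  rewrite ler_wpM2r// /c (bigD1 j)//= lerDl.
  by apply: sumr_ge0 => i' _; exact: sumr_ge0.
exists (p%:R * (c * c) + 1) => [|v w].
  by rewrite ltr_wpDl// !mulr_ge0.
apply: (@le_trans _ _ (p%:R * (c * c) * `|v - w| * (`|v| + `|w|))); last first.
  by rewrite !ler_wpM2r ?addr_ge0// lerDl.
rewrite /sqnorm_mul -sumrB; apply: (le_trans (ler_norm_sum _ _ _)).
have -> : p%:R * (c * c) * `|v - w| * (`|v| + `|w|) =
    \sum_(j < p) ((c * `|v - w|) * (c * (`|v| + `|w|))).
  by rewrite sumr_const card_ord -[in RHS]mulr_natl; ring.
apply: ler_sum => j _; rewrite subr_sqr normrM.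
have -> : (M *m v) j 0 - (M *m w) j 0 = (M *m (v - w)) j 0.
  by rewrite mulmxBr !mxE.
apply: ler_pM => //.
rewrite mulrDr; apply: (le_trans (ler_normD _ _)); exact: lerD.
Qed.

Lemma sqnorm_mul_abs_continuous (y : R -> 'cV[R]_q) a b : a <= b ->
  loc_abs_continuous y -> abs_continuous_on a b (fun t => sqnorm_mul (y t)).
Proof.
move=> ab acy e e0.
have [C C0 HC] := sqnorm_mul_dist.
have cy : {within `[a, b], continuous (fun t => `|y t|)}.
  apply: continuous_subspaceT => t; apply: continuous_comp.
    exact: loc_abs_continuous_continuous.
  exact: norm_continuous.
(* On [[a, b]] the curve is bounded by its norm at [c], so [sqnorm_mul] is Lipschitz along it. *)
have [c _ ymax] := EVT_max ab cy.
pose K := C * (`|y c| + `|y c|) + 1.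
have K0 : 0 < K by rewrite ltr_wpDl// mulr_ge0// ?(ltW C0)// addr_ge0.
have [d d0 H] := acy a b ab _ (divr_gt0 e0 K0).
exists d => // k s t st tr sd.
have := H k s t st tr sd; rewrite ltr_pdivlMr// mulrC; apply: le_lt_trans.
rewrite mulr_sumr; apply: ler_sum => i _.
apply: (le_trans (HC _ _)); rewrite mulrAC ler_wpM2r//.
apply: (@le_trans _ _ (C * (`|y c| + `|y c|))); last by rewrite lerDl.
have [asi sti tib] := st i.
rewrite ler_pM2l//; apply: lerD; apply: ymax; rewrite in_itv/=.
  by rewrite (le_trans asi sti).
by rewrite asi (le_trans sti tib).
Qed.

Lemma sqnorm_mul_cvg0 (y : R -> 'cV[R]_q) : y t @[t --> +oo] --> (0 : 'cV[R]_q) ->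
  forall e, 0 < e -> exists2 t, 0 <= t & sqnorm_mul (y t) < e.
Proof.
move=> y0 e e0; have [C C0 HC] := sqnorm_mul_dist.
(* Below 1 the norm dominates its square, so the quadratic bound becomes linear. *)
have d0 : 0 < Num.min 1 (e / C) by rewrite lt_min ltr01 divr_gt0.
suff : \forall t \near +oo, 0 <= t /\ sqnorm_mul (y t) < e.
  by move=> /filter_ex[t []]; exists t.
near=> t; split; first by near: t; apply: nbhs_pinfty_ge; rewrite num_real.
  have : `|0 - y t| < Num.min 1 (e / C).
    near: t; move/cvgrPdist_lt : y0; exact.
  rewrite sub0r normrN lt_min => /andP[y1 yC].
  have := HC (y t) 0; rewrite subr0 normr0 addr0.
  have -> : sqnorm_mul 0 = 0.
    by rewrite /sqnorm_mul big1// => j _; rewrite mulmx0 mxE expr0n.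
  rewrite subr0 => H; apply: (le_lt_trans (ler_norm _)); apply: (le_lt_trans H).
  move: yC; rewrite ltr_pdivlMr// mulrC; apply: le_lt_trans.
  by rewrite ler_piMr ?mulr_ge0 ?(ltW C0)// ltW.
Unshelve. all: by end_near. Qed.

End SquareNorm.

Lemma dissipation_not_stabilizable (R : realType) (l n m : nat)
    (E A : 'M[R]_(l, n)) (B : 'M[R]_(l, m)) (M : 'M[R]_(n, l)) :
  (0 < n)%N -> M *m B = 0 ->
  (forall x : 'cV[R]_n, x != 0 ->
    0 < ((M *m E *m x)^T *m (M *m A *m x)) 0 0) ->
  ~ strongly_stabilizable E A B.
Proof.
move=> n0 MB pos stab.
have pos0 (x : 'cV[R]_n) : 0 <= ((M *m E *m x)^T *m (M *m A *m x)) 0 0.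
  have [->|/pos/ltW//] := eqVneq x 0.
  by rewrite !mulmx0 mxE.
pose x0 : 'cV[R]_n := const_mx 1.
have x00 : x0 != 0.
  apply/eqP => /colP/(_ (Ordinal n0)); rewrite !mxE => /eqP.
  by rewrite oner_eq0.
have [[x u] [/= [_ _ acEx eqx] Ex0 Exoo]] := stab x0.
pose f t := sqnorm_mul M (E *m x t).
have f0 : 0 < f 0.
  rewrite /f Ex0 lt_neqAle sqnorm_mul_ge0 andbT eq_sym.
  apply/eqP => /eqP; rewrite psumr_eq0 => [/allP Mx0|j _]; last exact: sqr_ge0.
  (* [f 0 = 0] would make the positive form vanish at the nonzero vector [x0]. *)
  have KE : M *m E *m x0 = 0.
    apply/colP => j; rewrite -mulmxA [RHS]mxE.
    by have := Mx0 j (mem_index_enum _); rewrite sqrf_eq0 => /eqP.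
  by have := pos _ x00; rewrite KE trmx0 mul0mx mxE ltxx.
have [t t0] := sqnorm_mul_cvg0 M Exoo f0.
rewrite ltNge => /negP; apply; rewrite -/(f t).
apply: abs_continuous_nondecreasing => //.
  exact: sqnorm_mul_abs_continuous.
apply: (negligibleS _ eqx) => s; apply: contra_not => /= /(is_derive_mulmx M) dMEx.
have ME : M *m (A *m x s + B *m u s) = M *m A *m x s.
  by rewrite mulmxDr !mulmxA MB mul0mx addr0.
rewrite ME in dMEx.
exists (((M *m E *m x s)^T *m (M *m A *m x s)) 0 0 *+ 2); first exact: mulrn_wge0.
pose g (j : 'I_n) r := (M *m (E *m x r)) j 0.
have -> : f = \sum_(j < n) (g j * g j).
  by apply/funext => r; rewrite fct_sumE /f /sqnorm_mul.
rewrite mxE -sumrMnl; apply: is_derive_sum => j.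
have dg : is_derive s 1 (g j) ((M *m A *m x s) j 0).
  by move/is_derive_mxP : dMEx; exact.
apply: is_derive_eq.
by rewrite [(_^T) 0 j]mxE -[M *m E *m x s]mulmxA mulr2n.
Qed.

(** The error against [S], the sum of squares of the entries of [x], is at most [e * n%:R * S], by
    bounding each product of two entries by half the sum of their squares. *)
Lemma near_identity_pos (R : realFieldType) (n : nat) (Q : 'M[R]_n) (e : R) :
  0 <= e -> e * n%:R < 1 ->
  (forall i j, `|Q i j - (i == j)%:R| <= e) ->
  forall x : 'cV[R]_n, x != 0 -> 0 < (x^T *m Q *m x) 0 0.
Proof.
move=> e0 en Qe x x0.
pose S := \sum_i x i 0 ^+ 2.
have S0 : 0 < S.
  rewrite lt_neqAle eq_sym sumr_ge0 ?andbT => [|i _]; last exact: sqr_ge0.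
  apply: contra x0; rewrite psumr_eq0 => [/allP H|i _]; last exact: sqr_ge0.
  apply/eqP/colP => i; rewrite mxE; apply/eqP; rewrite -sqrf_eq0.
  exact: (H i (mem_index_enum _)).
have QE : (x^T *m Q *m x) 0 0 = \sum_j \sum_i Q i j * (x i 0 * x j 0).
  rewrite mxE; apply: eq_bigr => j _; rewrite mxE mulr_suml.
  by apply: eq_bigr => i _; rewrite mxE; ring.
have SE : S = \sum_j \sum_i (i == j)%:R * (x i 0 * x j 0).
  apply: eq_bigr => j _; rewrite (bigD1 j)//= eqxx mul1r big1 ?addr0//.
  by move=> i ij; rewrite (negbTE ij) mul0r.
have bound : - (e * n%:R * S) <= (x^T *m Q *m x) 0 0 - S.
  rewrite QE SE -sumrB -SE.
  have -> : - (e * n%:R * S) =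
      \sum_j \sum_i (- (e / 2) * (x i 0 ^+ 2 + x j 0 ^+ 2)).
    under eq_bigr do rewrite -mulr_sumr big_split /= sumr_const card_ord.
    rewrite -mulr_sumr big_split /= sumr_const card_ord sumrMnl -/S.
    by rewrite -[S *+ n]mulr_natl; field.
  apply: ler_sum => j _; rewrite -sumrB; apply: ler_sum => i _.
  rewrite -mulrBl mulNr lerNl; apply: (le_trans (ler_norm _)).
  rewrite normrN normrM -mulrA; apply: ler_pM => //.
  rewrite normrM.
  have := sqr_ge0 (`|x i 0| - `|x j 0|).
  rewrite sqrrB !real_normK ?num_real//; lra.
have : 0 < (1 - e * n%:R) * S by rewrite mulr_gt0// subr_gt0.
by rewrite mulrBl mul1r; lra.
Qed.

(** * An explicit neighbourhood of systems that are not stabilizable *)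

Section Annihilator.
Variables (S : comNzRingType) (l n m : nat).

Definition lower_rows : 'M[S]_(m, l) := \matrix_(i, j) (n + i == j :> nat)%:R.

(* Schur complement, cleared of denominators *)
Definition input_annihilator (B : 'M[S]_(l, m)) : 'M[S]_(n, l) :=
  \det (lower_rows *m B) *: pid_mx n -
  pid_mx n *m B *m \adj (lower_rows *m B) *m lower_rows.

(** Both terms times [B] equal [\det (lower_rows *m B)] times [pid_mx n *m B], even if that
    determinant is 0. *)
Lemma input_annihilatorP B : input_annihilator B *m B = 0.
Proof.
rewrite mulmxBl -scalemxAl -[_ *m lower_rows *m B]mulmxA.
by rewrite -[X in _ - X]mulmxA mul_adj_mx mul_mx_scalar subrr.
Qed.

(** With [M] the annihilator, the matrix of the form [(M E x)^T (M A x)]; without denominators it is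
    polynomial in the entries. *)
Definition dissipation (E A : 'M[S]_(l, n)) (B : 'M[S]_(l, m)) : 'M[S]_n :=
  (input_annihilator B *m E)^T *m (input_annihilator B *m A).

Lemma dissipation_base : (n + m <= l)%N ->
  dissipation (pid_mx n) (pid_mx n) (lower_rows^T) = 1%:M.
Proof.
move=> nml; have nl : (n <= l)%N := leq_trans (leq_addr _ _) nml.
have lowK : lower_rows *m lower_rows^T = 1%:M.
  apply/matrixP => i j; have nil : (n + i < l)%N.
    by rewrite (leq_trans _ nml)// ltn_add2l.
  rewrite mxE (bigD1 (Ordinal nil))//= !mxE eqxx mul1r big1 ?addr0 => [|k].
    by rewrite /= eqn_add2l eq_sym.
  move=> ki; rewrite !mxE; case: eqP => [e|_]; last by rewrite mul0r.
  by case/eqP: ki; apply/val_inj; rewrite /= -e.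
have pidlow : (pid_mx n : 'M[S]_(n, l)) *m lower_rows^T = 0.
  apply/matrixP => i j; rewrite !mxE big1// => k _; rewrite !mxE.
  case: (i =P k :> nat) => [<-|_]; last by rewrite mul0r.
  by rewrite gtn_eqF ?mulr0// ltn_addr.
have MB : input_annihilator (lower_rows^T) = pid_mx n.
  by rewrite /input_annihilator lowK det1 scale1r pidlow !mul0mx subr0.
rewrite /dissipation MB mul_pid_mx.
have -> : minn l (minn n n) = n by rewrite minnn; exact/minn_idPr.
by rewrite pid_mx_1 trmx1 mulmx1.
Qed.

End Annihilator.

Lemma map_dissipation (S T : comNzRingType) (f : {rmorphism S -> T}) (l n m : nat)
    (E A : 'M[S]_(l, n)) (B : 'M[S]_(l, m)) :
  dissipation (map_mx f E) (map_mx f A) (map_mx f B) =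
  map_mx f (dissipation E A B).
Proof.
have low : lower_rows T l n m = map_mx f (lower_rows S l n m).
  by apply/matrixP => i j; rewrite !mxE rmorph_nat.
rewrite /dissipation /input_annihilator low !map_mxM -matrix.map_trmx map_mxM.
by rewrite map_mxB map_mxZ !map_mxM map_mx_adj map_pid_mx -det_map_mx !map_mxM.
Qed.

Lemma dissipation_pos_not_stabilizable (R : realType) (l n m : nat)
    (E A : 'M[R]_(l, n)) (B : 'M[R]_(l, m)) (e : R) :
  (0 < n)%N -> 0 <= e -> e * n%:R < 1 ->
  (forall i j, `|dissipation E A B i j - (i == j)%:R| <= e) ->
  ~ strongly_stabilizable E A B.
Proof.
move=> n0 e0 en Qe.
apply: (dissipation_not_stabilizable (M := input_annihilator n B)) => // [|x x0].
  exact: input_annihilatorP.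
by have := near_identity_pos e0 en Qe x0; rewrite trmx_mul !mulmxA.
Qed.

Lemma not_generic_strongly_stabilizable (R : realType) (l n m : nat) :
  (0 < n)%N -> (n + m <= l)%N ->
  ~ generic (@Sigma_vec R l n m @`
      [set s : Sigma R l n m | strongly_stabilizable s.1.1 s.1.2 s.2]).
Proof.
move=> n0 nml.
pose v := @Sigma_vec R l n m (pid_mx n, pid_mx n, (lower_rows R l n m)^T).
move=> /(generic_near v)[w near_v].
(* The line with its parameter as indeterminate: the entries of [Q] become univariate polynomials,
   hence continuous in [t]. *)
pose pv := map_mx polyC v + 'X *: map_mx polyC (w - v).
pose Q := dissipation (vec_Sigma pv).1.1 (vec_Sigma pv).1.2 (vec_Sigma pv).2.
have QE t i j : (Q i j).[t] = dissipation (vec_Sigma (line v w t)).1.1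
    (vec_Sigma (line v w t)).1.2 (vec_Sigma (line v w t)).2 i j.
  have -> : line v w t = map_mx (horner_eval t) pv.
    by apply/rowP => k; rewrite !mxE /horner_eval !hornerE.
  have -> : (Q i j).[t] = map_mx (horner_eval t) Q i j by rewrite [RHS]mxE.
  by rewrite -map_dissipation /= !map_vec_mx !(map_lsubmx, map_rsubmx).
(* Chosen so that [e * n%:R < 1]. *)
pose e : R := n.+1%:R^-1.
have [d d0 Qd] : exists2 d : R, 0 < d & forall t, `|t| < d ->
    forall i j, `|(Q i j).[t] - (i == j)%:R| <= e.
  have Qnear (ij : 'I_n * 'I_n) : \forall t \near (0 : R),
      `|(Q ij.1 ij.2).[t] - (ij.1 == ij.2)%:R| <= e.
    case: ij => i j /=.
    have Q0 : (Q i j).[0] = (i == j)%:R.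
      by rewrite QE /line scale0r addr0 Sigma_vecK dissipation_base// mxE.
    have : horner (Q i j) t @[t --> (0 : R)] --> (Q i j).[0].
      exact: continuous_horner.
    move=> /cvgrPdist_le; rewrite Q0 => /(_ e); rewrite invr_gt0 ltr0n => /(_ isT).
    by apply: filterS => t; rewrite distrC.
  have [d /= d0 H] := filter_forall _ Qnear.
  exists d => // t td i j.
  by apply: (H t _ (i, j)); rewrite /= sub0r normrN.
have [t /andP[t0 td] [s stab sE]] := near_v d d0.
have {}sE : s = vec_Sigma (line v w t) by rewrite -sE Sigma_vecK.
move: stab; rewrite /= sE.
apply: (@dissipation_pos_not_stabilizable _ _ _ _ _ _ _ e) => //.
- by rewrite invr_ge0.
- by rewrite mulrC ltr_pdivrMr ?mul1r ?ltr_nat ?ltr0n.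
- by move=> i j; rewrite -QE; apply: Qd; rewrite gtr0_norm.
Qed.

Theorem proposition6p8 (R : realType) (l n m : nat)
    (hl : (0 < l)%N) (hn : (0 < n)%N) (hm : (0 < m)%N) :
  generic (@Sigma_vec R l n m @`
             [set s : Sigma R l n m | strongly_stabilizable s.1.1 s.1.2 s.2])
  <-> (l < n + m)%N.
Proof.
split=> [gen|lnm].
  rewrite ltnNge; apply/negP => nml.
  exact: not_generic_strongly_stabilizable gen.
apply: generic_of_criterion => // E A B /=.
exact: criterion_strongly_stabilizable.
Qed.
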